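(* Let $X_1,X_2\subset\mathbb{R}^d$ be closed and convex and let $c\in C^2(X)$, $X=X_1\times X_2$, be nondegenerate and of growth of order $2$. Suppose that $D^2_{xy}c(x,y)$ is uniformly continuous and that $\|D^2_{xy}c\|$ and $\|(D^2_{xy}c)^{-1}\|$ are bounded on $X$. Let $d'>d$. If $\mu_1\in\mathcal{P}(X_1)$, $\mu_2\in\mathcal{P}(X_2)$ satisfy $\mu_1,\mu_2\in\mathcal{P}_q(\mathbb{R}^d)$ for $q:=2\frac{d'+d}{d'-d}$, then any optimal transport (any minimizer of $\pi\mapsto\int c\,d\pi$ over $\Pi(\mu_1,\mu_2)$) satisfies ${\sf quant}_2(C,1/d')$ for some $C>0$.
   Context: $\mathcal{P}(Y)$ denotes the Borel probability measures on $Y$, $\mathcal{P}_q$ those with finite $q$-th moment, and $\Pi(\mu_1,\mu_2)$ the set of couplings. $c\in C^2(X)$ means that $c$ is defined and twice continuously differentiable on a neighborhood of $X$. Growth of order $2$ means $|c(z)|\le C'(1+|z|^2)$ on $X$ for some $C'\ge0$. $c$ is nondegenerate if the $d\times d$ matrix $D^2_{xy}c(x,y)=[\partial^2_{x_iy_j}c(x,y)]_{1\le i,j\le d}$ is invertible for all $(x,y)\in X$. $\|M\|$ is the operator norm of the matrix $M$. A measure $\pi$ with finite second moment on $Y=\mathbb{R}^d\times\mathbb{R}^d$ (Euclidean metric) satisfies ${\sf quant}_2(C,\alpha)$ if for every $n\ge1$ there is a probability measure $\pi^n$ on $Y$ supported on at most $n$ points with $W_2(\pi^n,\pi)\le Cn^{-\alpha}$,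 where $W_2$ is the 2-Wasserstein distance. *)

(* Defs.v *)
From HB Require Import structures.
From mathcomp Require Import all_boot all_order all_algebra.
From mathcomp Require Import all_classical all_reals all_analysis.

Set Implicit Arguments.
Unset Strict Implicit.
Unset Printing Implicit Defensive.

Import Order.TTheory GRing.Theory Num.Theory.
Import numFieldNormedType.Exports.

Local Open Scope classical_set_scope.
Local Open Scope ring_scope.

(* The Borel sigma-algebra of R^(m x n). A product such as
   'rV[R]_d * 'rV[R]_d then gets the library's product sigma-algebra, which is
   its Borel sigma-algebra because R^d is second countable. *)
Definition borel_mx_display (R : realType) (m n : nat) : measure_display :=
  sigma_display (@open 'M[R]_(m, n)).

HB.instance Definition _ (R : realType) (m n : nat) :=
  @isMeasurable.Build (borel_mx_display R m n) 'M[R]_(m, n)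
    <<s @open 'M[R]_(m, n) >>
    (@sigma_algebra0 _ setT (@open 'M[R]_(m, n)))
    (@sigma_algebraC _ (@open 'M[R]_(m, n)))
    (@sigma_algebra_bigcup _ setT (@open 'M[R]_(m, n))).

(* The library's norm on matrices and on products is the max norm: the
   Euclidean norms are introduced separately. They induce the same topology and
   the same uniform structure, so that open, closed, continuous and
   unif_continuous can be taken from the library. *)
Section euclidean.
Context {R : realType} {d : nat}.

Definition enorm (v : 'rV[R]_d) : R := Num.sqrt (\sum_(i < d) v 0 i ^+ 2).

Definition penorm (z : 'rV[R]_d * 'rV[R]_d) : R :=
  Num.sqrt (enorm z.1 ^+ 2 + enorm z.2 ^+ 2).

(* v *m M^T is the transpose of the column vector M v^T. *)
Definition opnorm (M : 'M[R]_d) : R :=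
  sup [set enorm (v *m M^T) | v in [set v | enorm v <= 1]].

End euclidean.

Section regularity.
Context {R : realType}.

(* f is only constrained on U, which is meant to be open. *)
Definition twice_cont_diff_on {V : normedModType R} (U : set V) (f : V -> R) :=
  forall z, U z ->
    [/\ differentiable f z,
        forall u, differentiable ('D_u f) z
      & forall u v, {for z, continuous ('D_v ('D_u f))}].

Definition C2 {V : normedModType R} (X : set V) (f : V -> R) :=
  exists U : set V, [/\ open U, X `<=` U & twice_cont_diff_on U f].

Context {d : nat}.
Implicit Types (c : 'rV[R]_d * 'rV[R]_d -> R) (X : set ('rV[R]_d * 'rV[R]_d)).

Definition D2xy c (z : 'rV[R]_d * 'rV[R]_d) : 'M[R]_d :=
  \matrix_(i, j) 'D_(delta_mx 0 i, 0) ('D_(0, delta_mx 0 j) c) z.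

Definition nondegenerate_on X c := forall z, X z -> D2xy c z \in unitmx.

Definition growth2 X c :=
  exists2 C : R, 0 <= C & forall z, X z -> `|c z| <= C * (1 + penorm z ^+ 2).

Definition opnorm_bounded_on X (M : 'rV[R]_d * 'rV[R]_d -> 'M[R]_d) :=
  exists K : R, forall z, X z -> opnorm (M z) <= K.

End regularity.

Section transport.
Context {R : realType}.

Section couplings.
Context d1 d2 (T1 : measurableType d1) (T2 : measurableType d2).

Definition couplings (mu1 : probability T1 R) (mu2 : probability T2 R) :
    set (probability (T1 * T2)%type R) :=
  [set pi : probability (T1 * T2)%type R |
     (forall A, measurable A -> pi (A `*` setT) = mu1 A) /\
     (forall B, measurable B -> pi (setT `*` B) = mu2 B)].

(* The integral is over X, which carries all couplings when mu1 and mu2 live on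
   the factors of X: the values of c outside X are irrelevant, and c need not
   even be measurable there. *)
Definition optimal_transport (X : set (T1 * T2)) (c : T1 * T2 -> R)
    (mu1 : probability T1 R) (mu2 : probability T2 R)
    (pi : probability (T1 * T2)%type R) :=
  couplings mu1 mu2 pi /\
  forall pi', couplings mu1 mu2 pi' ->
    (\int[pi]_(z in X) (c z)%:E <= \int[pi']_(z in X) (c z)%:E)%E.

End couplings.

Definition finite_moment d0 (T : measurableType d0) (nrm : T -> R) (q : R)
    (mu : probability T R) :=
  (\int[mu]_x (nrm x `^ q)%:E < +oo)%E.

Definition supported_on_at_most d0 (T : measurableType d0) (n : nat)
    (mu : probability T R) :=
  exists2 A : set T, (A #<= `I_n)%card & mu A = 1%E.

Context {d : nat}.
Local Notation Y := ('rV[R]_d * 'rV[R]_d)%type.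

Definition W2 (mu nu : probability Y R) : \bar R :=
  ((ereal_inf [set \int[gamma]_w (penorm (w.1 - w.2) ^+ 2)%:E
              | gamma in couplings mu nu]) `^ 2^-1)%E.

Definition quant2 (C alpha : R) (pi : probability Y R) :=
  finite_moment penorm 2 pi /\
  forall n : nat, (1 <= n)%N ->
    exists2 pin : probability Y R, supported_on_at_most n pin &
      (W2 pin pi <= (C * n%:R `^ (- alpha))%:E)%E.

End transport.

(* Main.v *)
(* Let [B] be the set of pairs [(z, z')], [z = (x, y)] and [z' = (x', y')],
   for which [c z + c z' > c (x, y') + c (x', y)].  Drawing [(z, z')] from
   [pi \x pi] and replacing [z] by [(x, y')] when the pair is in [B] gives a
   coupling, because [B] is symmetric, and this coupling is strictly cheaper
   unless [B] is null.  So almost every pair satisfies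
   [c z + c z' - c (x, y') - c (x', y) <= 0], and by the mean value theorem the
   left-hand side is [(x' - x) D (y' - y)] with [D] the mixed Hessian at some
   intermediate point.  On a cube of fixed size [h], [D] is close to a constant
   invertible matrix [A], and the inequality forces
   [|z - z'| <= L |(x - x') - A (y - y')|]: within the cube, [pi] lives on the
   graph of a Lipschitz map over a [d]-dimensional space.

   Hence, for [r >= 1 >= s], the part of [pi] in a ball of radius [r] is
   covered by [O(r^(2d) s^(-d))] cells of diameter [O(s)] (cubes of side [h],
   cut according to the value of [x - A y]).  One point per cell, and the
   origin for the complement of the ball, give an error whose square is
   [O(s^2 + r^(2-q))].  The choice [s = n^(-1/d')],
   [r = n^((d'-d)/(2dd'))] balances the two terms and makes the number of cells
   [O(n)]. *)
Require Import Defs.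
From mathcomp Require Import all_boot all_order all_algebra.
From mathcomp Require Import all_classical all_reals all_analysis.
From mathcomp Require Import measurable_realfun ring lra zify.

Set Implicit Arguments.
Unset Strict Implicit.
Unset Printing Implicit Defensive.

Import Order.TTheory GRing.Theory Num.Theory.
Import numFieldNormedType.Exports.

Local Open Scope classical_set_scope.
Local Open Scope ring_scope.

(** * Optimal couplings are pairwise monotone *)

(** Packages a pushforward as a [probability], the type that [couplings] and [W2] require. The
    equation is one of set functions, because the two sides carry different structures. *)
Lemma pushforward_probability d1 d2 (T1 : measurableType d1)
    (T2 : measurableType d2) (R : realType) (P : probability T1 R)
    (f : T1 -> T2) : measurable_fun setT f ->
  exists Q : probability T2 R, Q = pushforward P f :> (set T2 -> \bar R).
Proof.
move=> mf; pose X : {mfun T1 >-> T2} := mfun_Sub (mem_set mf).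
by exists (distribution P X).
Qed.

Section exchange.
Context d1 d2 (T1 : measurableType d1) (T2 : measurableType d2) (R : realType).
Local Notation T := (T1 * T2)%type.

(** The image of [pi \x pi] under the swap agrees with [pi \x pi] on rectangles, and a product
    measure is determined by its values there. *)
Lemma product_measure_swap (pi : probability T R) (A : set (T * T)) :
  measurable A -> (pi \x pi)%E [set w | A (w.2, w.1)] = (pi \x pi)%E A.
Proof.
move=> mA; have ms : measurable_fun setT (fun w : T * T => (w.2, w.1)).
  by apply: measurable_fun_pair; [exact: measurable_snd|exact: measurable_fst].
have [m' m'E] := @pushforward_probability _ _ _ _ _ (pi \x pi)%E _ ms.
have m'X B C : measurable B -> measurable C -> m' (B `*` C) = (pi B * pi C)%E.
  move=> mB mC; rewrite m'E /pushforward (_ : _ @^-1` _ = C `*` B).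
    by rewrite [LHS]product_measure1E// muleC.
  by apply/seteqP; split=> -[x y] [].
rewrite [RHS](product_measure_unique m'X) //.
exact: (congr1 (@^~ A) (esym m'E)).
Qed.

Lemma product_measureXT (pi : probability T R) (A : set T) :
  measurable A -> (pi \x pi)%E (A `*` setT) = pi A.
Proof.
move=> mA; rewrite product_measure1E //.
by have /= -> := probability_setT pi; rewrite mule1.
Qed.

Definition crossed (g : T -> R) (w : T * T) : bool :=
  g (w.1.1, w.2.2) + g (w.2.1, w.1.2) < g w.1 + g w.2.

Lemma measurable_cross1 : measurable_fun setT (fun w : T * T => (w.1.1, w.2.2)).
Proof.
apply: measurable_fun_pair => /=.
- exact: (measurableT_comp measurable_fst measurable_fst).
- exact: (measurableT_comp measurable_snd measurable_snd).
Qed.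

Lemma measurable_cross2 : measurable_fun setT (fun w : T * T => (w.2.1, w.1.2)).
Proof.
apply: measurable_fun_pair => /=.
- exact: (measurableT_comp measurable_fst measurable_snd).
- exact: (measurableT_comp measurable_snd measurable_fst).
Qed.

Lemma measurable_crossed (g : T -> R) :
  measurable_fun setT g -> measurable_fun setT (crossed g).
Proof.
move=> mg; apply: measurable_fun_ltr => //; apply: measurable_funD.
- exact: measurableT_comp mg measurable_cross1.
- exact: measurableT_comp mg measurable_cross2.
- exact: measurableT_comp mg measurable_fst.
- exact: measurableT_comp mg measurable_snd.
Qed.

Lemma crossedC g w : crossed g (w.2, w.1) = crossed g w.
Proof.
by rewrite /crossed /= addrC [g w.2 + _]addrC.
Qed.

(* [crossed g] is invariant under swapping the two draws, so on it [w.2.2] has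
   the same law as [w.1.2]: exchanging keeps the second marginal. *)
Definition exchange (g : T -> R) (w : T * T) : T :=
  if crossed g w then (w.1.1, w.2.2) else w.1.

Lemma measurable_exchange (g : T -> R) :
  measurable_fun setT g -> measurable_fun setT (exchange g).
Proof.
move=> mg; apply: measurable_fun_ifT; first exact: measurable_crossed.
- exact: measurable_cross1.
- exact: measurable_fst.
Qed.

Variables (mu1 : probability T1 R) (mu2 : probability T2 R).

Lemma couplings_exchange (g : T -> R) (pi pi' : probability T R) :
  measurable_fun setT g -> couplings mu1 mu2 pi ->
  pi' = pushforward (pi \x pi)%E (exchange g) :> (set T -> \bar R) ->
  couplings mu1 mu2 pi'.
Proof.
move=> mg [pi1 pi2] pi'E; split=> [A mA|B mB].
  rewrite pi'E /pushforward -pi1 //.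
  rewrite (_ : _ @^-1` _ = (A `*` setT) `*` setT); last first.
    apply/seteqP; rewrite /exchange; split=> -[[x y] [x' y']] /=;
    by case: ifP => _ /= [].
  by rewrite product_measureXT //; exact: measurableX.
pose BB := crossed g @^-1` [set true].
have mBB : measurable BB by rewrite -[BB]setTI; exact: measurable_crossed.
have mTB : measurable ((@setT T1) `*` B) by exact: measurableX.
have mTT C : measurable C -> measurable ((@setT T1 `*` C) `*` @setT T).
  by move=> mC; apply: measurableX => //; exact: measurableX.
have mTT' C : measurable C -> measurable (@setT T `*` (@setT T1 `*` C)).
  by move=> mC; apply: measurableX => //; exact: measurableX.
rewrite pi'E /pushforward -pi2 //.
rewrite (_ : _ @^-1` _ = (BB `&` (setT `*` (setT `*` B))) `|`
    (~` BB `&` ((setT `*` B) `*` setT))); last first.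
  apply/seteqP; rewrite /exchange /BB; split=> -[[x y] [x' y']] /=.
    by case: ifP => H /= [_ ?]; [left|right].
  by move=> [[H [_ [_ ?]]]|[H [[_ ?] _]]]; [rewrite H|case: ifP].
rewrite measureU /=; last 3 first.
- by apply: measurableI => //; exact: mTT'.
- by apply: measurableI; [exact: measurableC|exact: mTT].
- by rewrite setIACA setICr set0I.
(* Since [BB] is invariant under the swap, the constraint on [w.2.2] over [BB] becomes one on
   [w.1.2]. Both pieces then constrain [w.1.2], over [BB] and over its complement, and reassemble
   into the second marginal of [pi]. *)
rewrite -[X in (X + _)%E]product_measure_swap; last first.
  by apply: measurableI => //; exact: mTT'.
rewrite (_ : [set w | _] = BB `&` ((setT `*` B) `*` setT)); last first.
  apply/seteqP; split=> -[z z']; rewrite /BB /= (crossedC g (z, z'));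
  by move=> [? [? ?]].
rewrite -measureU /=; last 3 first.
- by apply: measurableI => //; exact: mTT.
- by apply: measurableI; [exact: measurableC|exact: mTT].
- by rewrite setIACA setICr set0I.
by rewrite -setIUl setUCr setTI product_measureXT.
Qed.

(** The cost change [F] of the exchange has nonnegative integral by optimality. Its symmetrization
    [G] under the swap has twice this integral, yet is nonpositive everywhere and negative on
    crossed pairs. So [G] vanishes almost everywhere, and crossed pairs form a null set. *)
Lemma optimal_not_crossed (g : T -> R) (pi : probability T R) :
  measurable_fun setT g -> couplings mu1 mu2 pi ->
  (forall pi' : probability T R, couplings mu1 mu2 pi' ->
    pi'.-integrable setT (EFin \o g)) ->
  (forall pi' : probability T R, couplings mu1 mu2 pi' ->
    (\int[pi]_z (g z)%:E <= \int[pi']_z (g z)%:E)%E) ->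
  (pi \x pi)%E [set w | crossed g w] = 0%E.
Proof.
move=> mg cpi ig opt; set pp := (pi \x pi)%E.
have push (f : T * T -> T) (pi' : probability T R) :
    measurable_fun setT f -> pi' = pushforward pp f :> (set T -> \bar R) ->
    couplings mu1 mu2 pi' ->
    pp.-integrable setT (EFin \o (g \o f)) /\
    (\int[pi']_z (g z)%:E = \int[pp]_w (g (f w))%:E)%E.
  move=> mf pi'E cpi'.
  have igf : pp.-integrable setT (EFin \o (g \o f)).
    apply/integrableP; split; first by apply/measurable_EFinP; exact: measurableT_comp.
    have /integrableP[_] := ig _ cpi'.
    rewrite pi'E ge0_integral_pushforward //.
    by apply: measurableT_comp => //; exact/measurable_EFinP.
  by split=> //; rewrite pi'E integral_pushforward //; exact/measurable_EFinP.
have mE := measurable_exchange mg.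
have [pi1 pi1E] := @pushforward_probability _ _ _ _ _ pp _ mE.
(* [pi2] is [pi] again, seen as the law of the first draw, so that both costs become integrals
   against [pp]. *)
have [pi2 pi2E] := @pushforward_probability _ _ _ _ _ pp _ measurable_fst.
have pi2_pi A : measurable A -> pi2 A = pi A.
  move=> mA; rewrite pi2E -(product_measureXT pi mA); congr (pp _).
  by apply/seteqP; split=> -[z z'] //= [].
have cpi1 := couplings_exchange mg cpi pi1E.
have cpi2 : couplings mu1 mu2 pi2.
  by case: cpi => c1 c2; split=> A mA; rewrite pi2_pi ?c1 ?c2 //;
    exact: measurableX.
have [iE IE] := push _ _ mE pi1E cpi1.
have [i1 I1] := push _ _ measurable_fst pi2E cpi2.
pose F w := ((g (exchange g w))%:E - (g w.1)%:E)%E.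
have iF : pp.-integrable setT F by exact: integrableB.
have IF : (0 <= \int[pp]_w F w)%E.
  rewrite integralB // sube_ge0; last first.
    by rewrite orbC integrable_fin_num.
  rewrite -IE -I1; apply: le_trans (opt _ cpi1).
  by rewrite (eq_measure_integral pi) // => A mA _; exact: pi2_pi.
pose sw (w : T * T) := (w.2, w.1).
have msw : measurable_fun setT sw.
  by apply: measurable_fun_pair; [exact: measurable_snd|exact: measurable_fst].
have swpp A : measurable A -> pushforward pp sw A = pp A.
  by move=> mA; rewrite -[RHS]product_measure_swap.
have swI h : (\int[pp]_w h w = \int[pushforward pp sw]_w h w)%E.
  by apply: eq_measure_integral => A mA _; exact/esym/swpp.
have iF' : pp.-integrable setT (F \o sw).
  apply/integrableP; split.
    by apply: measurableT_comp => //; exact: measurable_int iF.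
  have /integrableP[mF] := iF.
  by rewrite swI ge0_integral_pushforward //; exact: measurableT_comp.
have IF' : (\int[pp]_w F (sw w) = \int[pp]_w F w)%E.
  by rewrite [RHS]swI integral_pushforward //; exact: measurable_int iF.
(* [F] alone compares [g (x, y')] with [g (x, y)] and has no sign; the sum over both orders of the
   draws gives the full exchange of four terms. *)
pose G w := (F w + F (sw w))%E.
have GE w : G w = if crossed g w then (g (w.1.1, w.2.2) + g (w.2.1, w.1.2)
    - (g w.1 + g w.2))%:E else 0%E.
  rewrite /G /F /exchange crossedC /=; case: ifP => _ /=; last first.
    by rewrite !subee // adde0.
  by rewrite -!EFinB -EFinD; congr EFin; ring.
have G0 w : (G w <= 0)%E.
  rewrite GE; case: ifP => // c; rewrite lee_fin subr_le0; exact: ltW.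
have iG : pp.-integrable setT G by exact: integrableD.
have IG : (\int[pp]_w `|G w| = 0)%E.
  apply/eqP; rewrite eq_le integral_ge0 // andbT.
  under eq_integral do rewrite lee0_abs //.
  rewrite integralN; last first.
    exact: integrable_add_def.
  by rewrite oppe_le0 integralD // IF' adde_ge0.
have mG := measurable_int _ iG.
have /(ae_eq_integral_abs pp measurableT mG) := IG.
move=> [N [mN N0 GN]].
apply/eqP; rewrite eq_le measure_ge0 andbT -N0.
apply: le_measure; rewrite ?inE //.
  by rewrite (_ : [set w | _] = crossed g @^-1` [set true]) // -[X in measurable X]setTI;
    exact: measurable_crossed.
move=> w /= cw; apply: GN => /= /(_ I); rewrite GE cw => -[] /eqP.
by rewrite subr_eq0 lt_eqF.
Qed.
End exchange.

(** * Borel sets and measurable functions on R^d x R^d *)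

Lemma floor_div_near (R : realType) (t : R) (k : nat) :
  `|(Num.floor (t * k.+1%:R))%:~R / k.+1%:R - t| < 2 / k.+1%:R.
Proof.
set m := Num.floor _; set K : R := k.+1%:R.
have K0 : 0 < K by [].
rewrite -[X in _ - X](mulfK (lt0r_neq0 K0)) -mulrBl normrM [`|K^-1|]gtr0_norm ?invr_gt0 //.
rewrite ltr_pM2r ?invr_gt0 //.
have : m%:~R <= t * K by exact: floor_le.
have : t * K < (m + 1)%:~R by exact: floorD1_gt.
rewrite intrD ltr_norml => ? ?; apply/andP; split; lra.
Qed.

Section borel.
Context {R : realType} {d : nat}.
Local Notation V := 'rV[R]_d.

Lemma enorm_sqr (v : V) : enorm v ^+ 2 = \sum_(i < d) v 0 i ^+ 2.
Proof. by rewrite sqr_sqrtr // sumr_ge0 // => i _; exact: sqr_ge0. Qed.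

Lemma penorm_sqr (z : V * V) : penorm z ^+ 2 = enorm z.1 ^+ 2 + enorm z.2 ^+ 2.
Proof. by rewrite sqr_sqrtr // addr_ge0 // sqr_ge0. Qed.

Lemma open_measurable_rV (U : set V) : open U -> measurable U.
Proof. by move=> oU; apply: sub_sigma_algebra. Qed.

Lemma closed_measurable_rV (U : set V) : closed U -> measurable U.
Proof.
move=> cU; rewrite -[U]setCK; apply: measurableC; apply: open_measurable_rV.
exact: closed_openC.
Qed.

Lemma measurable_coord (i : 'I_d) : measurable_fun setT (fun v : V => v 0 i).
Proof.
apply: (measurability _ (RGenOpens.measurableE R)) => //.
move=> _ [_ [x [y ->]] <-]; rewrite setTI; apply: open_measurable_rV.
by apply: open_comp => [v _|]; [exact: coord_continuous|exact: interval_open].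
Qed.

Lemma measurable_coord1 (i : 'I_d) : measurable_fun setT (fun z : V * V => z.1 0 i).
Proof. exact: measurableT_comp (measurable_coord i) measurable_fst. Qed.

Lemma measurable_coord2 (i : 'I_d) : measurable_fun setT (fun z : V * V => z.2 0 i).
Proof. exact: measurableT_comp (measurable_coord i) measurable_snd. Qed.

Lemma measurable_enorm : measurable_fun setT (@enorm R d).
Proof.
apply: measurableT_comp.
  by apply: continuous_measurable_fun; exact: sqrt_continuous.
by apply: measurable_sum => i; apply: measurable_funX; exact: measurable_coord.
Qed.

Lemma measurable_penorm : measurable_fun setT (@penorm R d).
Proof.
apply: measurableT_comp.
  by apply: continuous_measurable_fun; exact: sqrt_continuous.
by apply: measurable_funD; apply: measurable_funX;
  apply: (measurableT_comp measurable_enorm);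
  [exact: measurable_fst|exact: measurable_snd].
Qed.

Lemma measurable_penormB :
  measurable_fun setT (fun w : (V * V) * (V * V) => penorm (w.1 - w.2) ^+ 2).
Proof.
under eq_fun do rewrite penorm_sqr !enorm_sqr.
apply: measurable_funD; apply: measurable_sum => i; apply: measurable_funX;
  under eq_fun do rewrite !mxE; apply: measurable_funB.
- exact: measurableT_comp (measurable_coord1 i) measurable_fst.
- exact: measurableT_comp (measurable_coord1 i) measurable_snd.
- exact: measurableT_comp (measurable_coord2 i) measurable_fst.
- exact: measurableT_comp (measurable_coord2 i) measurable_snd.
Qed.

(** Second countability: [W] is the union of the products of two balls, with centres in a grid of
    step [1 / k.+1] and radius [e k], that it contains. There are countably many of them, and each
    is a measurable rectangle. *)
Lemma open_measurable_prod (W : set (V * V)) : open W -> measurable W.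
Proof.
move=> oW.
pose q (k : nat) (v : 'rV[int]_d) : V := \row_i ((v 0 i)%:~R / k.+1%:R).
pose e (k : nat) : R := 2 / k.+1%:R.
have e_gt0 k : 0 < e k by rewrite divr_gt0.
pose I := (nat * ('rV[int]_d * 'rV[int]_d))%type.
pose B (j : I) : set (V * V) :=
  ball (q j.1 j.2.1) (e j.1) `*` ball (q j.1 j.2.2) (e j.1).
have mB j : measurable (B j).
  by apply: measurableX; apply: open_measurable_rV; exact: ball_open.
rewrite (_ : W = \bigcup_(j in [set: {j : I | `[< B j `<=` W >]}]) B (val j)).
  by apply: countable_bigcupT_measurable => [|j]; [exact: countableP|exact: mB].
apply/seteqP; split=> [z Wz|z [j _]]; last by case: j => j /= /asboolP; exact.
have /nbhs_ballP[r /= r0 rW] : nbhs z W by exact: open_nbhs_nbhs.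
(* This makes [2 * e k = 4 / k.+1] smaller than [r], so a ball of radius [e k] that contains a point
   lies in the ball of radius [r] around that point. *)
pose k := Num.truncn (4 / r).
have kr : 2 * e k < r.
  rewrite /e mulrA (_ : 2 * 2 = 4); last by ring.
  by rewrite ltr_pdivrMr // mulrC -ltr_pdivrMr // truncnS_gt.
pose fl (v : V) : 'rV[int]_d := \row_i Num.floor (v 0 i * k.+1%:R).
have flP v : ball (q k (fl v)) (e k) v.
  split=> // i j; rewrite (ord1 i) /ball /= !mxE.
  exact: floor_div_near.
have BW : B (k, (fl z.1, fl z.2)) `<=` W.
  move=> [x y] [/= Bx By]; apply: rW; apply: (@le_ball _ _ _ (2 * e k)).
    exact: ltW.
  rewrite (_ : 2 * e k = e k + e k); last by ring.
  by split=> /=; apply: (ball_triangle (ball_sym (flP _))).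
have jP : `[< B (k, (fl z.1, fl z.2)) `<=` W >] by exact/asboolP.
by exists (exist (fun j => is_true `[< B j `<=` W >]) _ jP) => //=; split; exact: flP.
Qed.
End borel.

(** * Quantizers from measurable partitions *)

Section quantization.
Context {R : realType} {d : nat}.
Local Notation V := 'rV[R]_d.
Local Notation Y := (V * V)%type.

(** The law of [(T z, z)] under [pi] is a coupling, and its cost bounds the infimum in [W2]. *)
Lemma W2_pushforward (pi pin : probability Y R) (T : Y -> Y) (e : R) :
  measurable_fun setT T -> pin = pushforward pi T :> (set Y -> \bar R) ->
  0 <= e -> (\int[pi]_z (penorm (T z - z) ^+ 2)%:E <= (e ^+ 2)%:E)%E ->
  (W2 pin pi <= e%:E)%E.
Proof.
move=> mT pinE e0 Te.
have mTi : measurable_fun setT (fun z => (T z, z)).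
  by apply: measurable_fun_pair => //; exact: measurable_id.
have [gam gamE] := @pushforward_probability _ _ _ _ _ pi _ mTi.
have cg : couplings pin pi gam.
  split=> [A mA|B mB].
    rewrite gamE pinE /pushforward; congr (pi _).
    by apply/seteqP; split=> z //= [].
  rewrite gamE /pushforward; congr (pi _).
  by apply/seteqP; split=> z //= [].
have ge0 (g : probability (Y * Y)%type R) :
    (0 <= \int[g]_w (penorm (w.1 - w.2) ^+ 2)%:E)%E.
  by apply: integral_ge0 => w _; rewrite lee_fin sqr_ge0.
rewrite /W2 (_ : e%:E = ((e ^+ 2)%:E `^ 2^-1)%E); last first.
  by rewrite poweR_EFin powR12_sqrt ?sqr_ge0 // sqrtr_sqr ger0_norm.
apply: gt0_ler_poweR; rewrite ?invr_ge0 // ?in_itv /= ?leey ?andbT.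
- by apply: le_ereal_inf_tmp => _ [g _ <-].
- by rewrite lee_fin sqr_ge0.
apply: le_trans Te; apply: ereal_inf_lbound; exists gam => //.
rewrite gamE ge0_integral_pushforward //.
- by apply/measurable_EFinP; exact: measurable_penormB.
- by move=> w _; rewrite lee_fin sqr_ge0.
Qed.

End quantization.

(** * Finite ranges and the choice of a cell in a finite cover *)

Lemma card_range_finType (J : finType) (T : Type) (f : J -> T) :
  (f @` [set: J] #<= `I_#|J|)%card.
Proof.
have [j0 _|J0] := pickP (@predT J); last first.
  rewrite (_ : f @` _ = set0); first exact: card_ge0.
  by apply/seteqP; split=> // y [j _ _]; have := J0 j.
apply: card_le_trans (card_image_le (fun k => f (nth j0 (enum J) k)) _).
apply: subset_card_le => _ [j _ <-]; exists (index j (enum J)).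
  by rewrite /= cardE index_mem mem_enum.
by rewrite nth_index // mem_enum.
Qed.

Section cover.
Context d (T : measurableType d) (K : finType) (P : K -> set T).

(** Cells may overlap; taking the first one in the enumeration turns the cover into a partition,
    with [None] for the uncovered points. *)
Definition cover_pick (z : T) : option K := [pick i | `[< P i z >]].

(** The choice at [z] depends only on the set [S] of indices whose cells contain [z]. For each of
    the finitely many [S], the points with this index set form a finite intersection [F S] of cells
    and complements. *)
Lemma measurable_cover_pick d' (T' : measurableType d') (f : option K -> T') :
  (forall i, measurable (P i)) -> measurable_fun setT (f \o cover_pick).
Proof.
move=> mP _ A mA; rewrite setTI.
pose F (S : {set K}) := \bigcap_(i in [set: K])
  (if i \in S then P i else ~` P i).
rewrite (_ : _ @^-1` _ =
    \bigcup_(S in [set S : {set K} | A (f [pick i | i \in S])]) F S).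
  apply: fin_bigcup_measurable => [|S _]; first exact: finite_finset.
  apply: fin_bigcap_measurable => [|i _]; first exact: finite_finset.
  by case: ifP => _; [|exact: measurableC].
have FP S z : F S z -> cover_pick z = [pick i | i \in S].
  move=> FSz; apply: eq_pick => i /=; have := FSz i I.
  by case: ifP => _ h; apply/asboolP.
apply/seteqP; split=> [z /= Az|z [S AS /FP zS]]; last by rewrite /= zS.
pose S := [set i | `[< P i z >]]%SET.
have FSz : F S z.
  by move=> i _; rewrite inE; case: asboolP.
by exists S => //=; rewrite -(FP _ _ FSz).
Qed.
End cover.

Lemma ae_probability1 d (T : measurableType d) (R : realType)
    (pi : probability T R) (A : set T) :
  measurable A -> pi A = 1%E -> {ae pi, forall z, A z}.
Proof.
move=> mA A1; exists (~` A); split => //; first exact: measurableC.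
by rewrite probability_setC // A1 subee.
Qed.

Lemma enormN (R : realType) (d : nat) (v : 'rV[R]_d) : enorm (- v) = enorm v.
Proof. by congr Num.sqrt; apply: eq_bigr => i _; rewrite mxE sqrrN. Qed.

Lemma penormN (R : realType) (d : nat) (z : 'rV[R]_d * 'rV[R]_d) :
  penorm (- z) = penorm z.
Proof. by rewrite /penorm !enormN. Qed.

Section quantization_cover.
Context {R : realType} {d : nat}.
Local Notation V := 'rV[R]_d.
Local Notation Y := (V * V)%type.
Variables (pi : probability Y R) (X : set Y) (N : set (Y * Y)).
Variables (K : finType) (P : K -> set Y) (e : R).
Hypotheses (mX : measurable X) (piX : pi X = 1%E).
Hypotheses (mN : measurable N) (piN : (pi \x pi)%E N = 0%E).
Hypothesis mP : forall i, measurable (P i).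
Hypothesis close : forall i z z', X z -> X z' -> P i z -> P i z' ->
  ~ N (z, z') -> penorm (z - z') <= e.

(* Each cell is represented by one of its points [p] such that almost every
   [z] is a good partner of [p]; Fubini provides such points. *)
Lemma quantization_map : exists T : Y -> Y,
  [/\ measurable_fun setT T, (range T #<= `I_#|K|.+1)%card &
    {ae pi, forall z, X z /\
      ((forall i, ~ P i z) /\ T z = 0 \/ penorm (T z - z) <= e)}].
Proof.
pose G := X `&` [set z | pi (xsection N z) = 0%E].
have aeG : {ae pi, forall z, G z}.
  apply: filterI; first exact: ae_probability1.
  have msec := measurable_fun_xsection pi mN.
  have : (\int[pi]_z `|pi (xsection N z)| = 0)%E.
    by under eq_integral do rewrite gee0_abs //.
  move/(ae_eq_integral_abs pi measurableT msec).
  by apply: filterS => z /(_ Logic.I).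
(* The default [0] is taken only when [P i] contains no point of [G]; almost no [z] lies in such a
   cell, because almost every [z] is in [G]. Uncovered points are sent to the origin, which accounts
   for the [.+1] in the cardinality. *)
pose p i := xget 0 (P i `&` G).
pose f (o : option K) := if o is Some i then p i else 0.
exists (f \o cover_pick P); split.
- exact: measurable_cover_pick.
- have := card_range_finType f; rewrite card_option; apply: card_le_trans.
  by apply: subset_card_le => _ [z _ <-]; exists (cover_pick P z).
have aeN : {ae pi, forall z, forall i, G (p i) -> ~ N (p i, z)}.
  apply: filter_forall => i; have [Gp|nGp] := pselect (G (p i)).
    exists (xsection N (p i)); split; [exact: measurable_xsection|by case: Gp|].
    by move=> z; rewrite /xsection /= inE => /not_implyP[_ /contrapT].
  by apply: filterS aeG => z _ /nGp.
apply: filterS2 aeG aeN => z Gz Nz; split; first by case: Gz.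
rewrite /= /cover_pick; case: pickP => [i /asboolP Piz|nP]; last first.
  by left; split=> // i; have /asboolP := nP i.
have [Pp Gp] : (P i `&` G) (p i) by rewrite /p; case: xgetP => // /(_ z) /not_andP[].
by right; case: Gz => Xz _; case: (Gp) => Xp _; exact: close Xp Xz Pp Piz (Nz i Gp).
Qed.

(** Covered points cost at most [e ^+ 2]. An uncovered [z] is sent to the origin and has norm at
    least [r], so its cost is [|z|^2 = |z|^(2-q) |z|^q <= r^(2-q) |z|^q], because [2 - q <= 0]. *)
Lemma quantization_W2 (q r : R) : 0 <= e -> 0 < r -> 2 <= q ->
  (forall z, X z -> (forall i, ~ P i z) -> r <= penorm z) ->
  exists2 pin : probability Y R, supported_on_at_most #|K|.+1 pin &
    forall b : R, 0 <= b -> (\int[pi]_z (penorm z `^ q)%:E <= b%:E)%E ->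
    (W2 pin pi <= (Num.sqrt (e ^+ 2 + r `^ (2 - q) * b))%:E)%E.
Proof.
move=> e0 r0 q2 tail; have [T [mT cT Tae]] := quantization_map.
have [pin pinE] := @pushforward_probability _ _ _ _ _ pi _ mT.
exists pin.
  exists (range T) => //; rewrite pinE /pushforward preimage_range.
  exact: probability_setT.
move=> b b0 piq; apply: (W2_pushforward mT pinE); first exact: sqrtr_ge0.
have rq0 : 0 <= r `^ (2 - q) by exact: powR_ge0.
rewrite sqr_sqrtr; last by rewrite addr_ge0 ?sqr_ge0 ?mulr_ge0.
have mTz : measurable_fun setT (fun z => penorm (T z - z) ^+ 2).
  apply: (measurableT_comp measurable_penormB (g := fun z => (T z, z))).
  by apply: measurable_fun_pair => //; exact: measurable_id.
have mq : measurable_fun setT (fun z : Y => penorm z `^ q).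
  exact: measurableT_comp (measurable_powR q) measurable_penorm.
have mrq : measurable_fun setT (fun z : Y => r `^ (2 - q) * penorm z `^ q).
  by apply: measurable_funM.
apply: (@le_trans _ _
  (\int[pi]_z ((e ^+ 2)%:E + (r `^ (2 - q) * penorm z `^ q)%:E))%E).
  apply: ae_ge0_le_integral => //.
  - by move=> z _; rewrite lee_fin sqr_ge0.
  - exact/measurable_EFinP.
  - by move=> z _; rewrite -EFinD lee_fin addr_ge0 ?sqr_ge0 ?mulr_ge0 ?powR_ge0.
  - by apply: emeasurable_funD => //; exact/measurable_EFinP.
  apply: filterS Tae => z [Xz Tz] _; rewrite -EFinD lee_fin.
  have p0 : 0 <= penorm z by exact: sqrtr_ge0.
  case: Tz => [[nP ->]|Tz]; last first.
    rewrite ler_wpDr ?mulr_ge0 ?powR_ge0 // ler_sqr ?nnegrE //; exact: sqrtr_ge0.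
  have rz := tail _ Xz nP; rewrite ler_wpDl ?sqr_ge0 //.
  have pz : 0 < penorm z by exact: lt_le_trans rz.
  rewrite sub0r penormN -[_ ^+ 2]powR_mulrn // -{1}(subrK q 2%:R) powRD; last first.
    by rewrite (gt_eqF pz) implybT.
  rewrite ler_wpM2r ?powR_ge0 // -opprB !powRN lef_pV2 ?posrE ?powR_gt0 //.
  by rewrite ge0_ler_powR ?subr_ge0 ?nnegrE // ltW.
rewrite ge0_integralD //; last 3 first.
- by move=> z _; rewrite lee_fin sqr_ge0.
- by move=> z _; rewrite lee_fin mulr_ge0 ?powR_ge0.
- exact/measurable_EFinP.
rewrite integral_cst //; have /= -> := probability_setT pi.
rewrite mule1 EFinD leeD2l //.
under eq_integral do rewrite EFinM.
rewrite ge0_integralZl //; last 2 first.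
- exact/measurable_EFinP.
- by move=> z _; rewrite lee_fin powR_ge0.
by rewrite EFinM lee_wpmul2l // lee_fin.
Qed.
End quantization_cover.

(** * Second order mean value theorem *)

Lemma convex_set_line (R : realType) (W : lmodType R) (A : set W) (x x' : W) (s : R) :
  convex_set (A : set (convex_lmodType W)) -> A x -> A x' -> 0 <= s -> s <= 1 ->
  A (x + s *: (x' - x)).
Proof.
move=> cA Ax Ax' s0 s1.
have /= := cA x' x (Itv01 s0 s1); rewrite !inE => /(_ Ax' Ax).
suff -> : x + s *: (x' - x) = s *: x' + (1 - s) *: x by [].
by rewrite scalerBr scalerBl scale1r addrCA.
Qed.

Section line.
Context {R : realType} {W : normedModType R}.

Lemma is_derive_line (f : W -> R) (a v : W) (t : R) :
  differentiable f (a + t *: v) ->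
  is_derive t 1 (fun s => f (a + s *: v)) ('D_v f (a + t *: v)).
Proof.
move=> df; have /derivableP[df1 df2] := @diff_derivable _ _ _ _ _ v df.
have E : (fun h : R => h^-1 *: (((fun s => f (a + s *: v)) \o shift t) (h *: 1) -
      f (a + t *: v))) =
    (fun h => h^-1 *: ((f \o shift (a + t *: v)) (h *: v) - f (a + t *: v))).
  apply/funext => h /=; congr (_ *: (f _ - _)).
  by rewrite /shift /= [h *: 1]mulr1 scalerDl addrCA.
by split; rewrite /derivable /derive E.
Qed.

Lemma line_MVT (f : W -> R) (a v : W) :
  (forall t : R, 0 <= t -> t <= 1 -> differentiable f (a + t *: v)) ->
  exists t : R, [/\ 0 <= t, t <= 1 & f (a + v) - f a = 'D_v f (a + t *: v)].
Proof.
move=> df; pose F t := f (a + t *: v); pose dF t := 'D_v f (a + t *: v).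
have dFP (t : R) : t \in `[0, 1] -> is_derive t 1 F (dF t).
  by rewrite in_itv /= => /andP[t0 t1]; apply: is_derive_line; exact: df.
have dFo (t : R) : t \in `]0, 1[ -> is_derive t 1 F (dF t).
  by move=> t01; apply: dFP; exact: subset_itv_oo_cc.
have cF : {within `[0, 1], continuous F}.
  by apply: derivable_within_continuous => t /dFP[].
have [t] := MVT_segment (@ler01 R) dFo cF.
rewrite in_itv /= => /andP[t0 t1].
rewrite /F /dF scale1r scale0r addr0 subr0 mulr1 => E.
by exists t.
Qed.
End line.

Section mixed.
Context {R : realType} {d : nat}.
Local Notation V := 'rV[R]_d.
Local Notation Y := (V * V)%type.

Lemma derive_coord2 (f : Y -> R) (p : Y) (v : V) : differentiable f p ->
  'D_(0, v) f p = \sum_j v 0 j * 'D_(0, delta_mx 0 j) f p.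
Proof.
move=> df; rewrite deriveE //.
have -> : (0, v) = \sum_j v 0 j *: (0, delta_mx 0 j) :> Y.
  rewrite {1}(row_sum_delta v).
  rewrite (big_morph (fun w : V => (0, w) : Y) (id1 := 0) (op1 := +%R)) //.
    by apply: eq_bigr => j _; congr pair; rewrite scaler0.
  by move=> w w'; congr pair; rewrite addr0.
by rewrite linear_sum; apply: eq_bigr => j _; rewrite linearZ deriveE.
Qed.

Lemma derive_coord1 (f : Y -> R) (p : Y) (v : V) : differentiable f p ->
  'D_(v, 0) f p = \sum_i v 0 i * 'D_(delta_mx 0 i, 0) f p.
Proof.
move=> df; rewrite deriveE //.
have -> : (v, 0) = \sum_j v 0 j *: (delta_mx 0 j, 0) :> Y.
  rewrite {1}(row_sum_delta v).
  rewrite (big_morph (fun w : V => (w, 0) : Y) (id1 := 0) (op1 := +%R)) //.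
    by apply: eq_bigr => j _; congr pair; rewrite scaler0.
  by move=> w w'; congr pair; rewrite addr0.
by rewrite linear_sum; apply: eq_bigr => j _; rewrite linearZ deriveE.
Qed.

(** Two mean value theorems: first in [y], for the difference of [c] at [x'] and at [x], then in
    [x], for the resulting derivative along [dy]. This is the order of differentiation in [D2xy], so
    no symmetry of second derivatives enters. Convexity keeps the intermediate points in
    [X1]*[X2]. *)
Lemma mixed_MVT (X1 X2 : set V) (c : Y -> R) (x x' y y' : V) :
  convex_set X1 -> convex_set X2 -> C2 (X1 `*` X2) c ->
  X1 x -> X1 x' -> X2 y -> X2 y' ->
  exists s t, [/\ 0 <= s <= 1, 0 <= t <= 1 &
   c (x', y') + c (x, y) - (c (x, y') + c (x', y)) =
   \sum_i (x' - x) 0 i * \sum_j (y' - y) 0 j *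
      D2xy c (x + s *: (x' - x), y + t *: (y' - y)) i j].
Proof.
move=> cX1 cX2 [U [_ XU cU]] Xx Xx' Xy Xy'.
set dx := x' - x; set dy := y' - y.
have X1s s : 0 <= s -> s <= 1 -> X1 (x + s *: dx) by exact: convex_set_line.
have X2s s : 0 <= s -> s <= 1 -> X2 (y + s *: dy) by exact: convex_set_line.
have dc z : X1 z.1 -> X2 z.2 -> differentiable c z.
  by move=> z1 z2; have [] := cU z (XU _ (conj z1 z2)).
have dDc z u : X1 z.1 -> X2 z.2 -> differentiable ('D_u c) z.
  by move=> z1 z2; have [] := cU z (XU _ (conj z1 z2)).
pose F t := c (x', y + t *: dy) - c (x, y + t *: dy).
pose dF t := 'D_(0, dy) c (x', y + t *: dy) - 'D_(0, dy) c (x, y + t *: dy).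
have line z t : (z, y + t *: dy) = (z, y) + t *: (0, dy) :> Y.
  by congr pair; rewrite /= scaler0 addr0.
have dFP (t : R) : t \in `[0, 1] -> is_derive t 1 F (dF t).
  rewrite in_itv /= => /andP[t0 t1].
  have cx' : is_derive t 1 (fun s => c (x', y + s *: dy)) ('D_(0, dy) c (x', y + t *: dy)).
    under eq_fun do rewrite line; rewrite line; apply: is_derive_line.
    by rewrite -line; apply: dc => //=; exact: X2s.
  have cx : is_derive t 1 (fun s => c (x, y + s *: dy)) ('D_(0, dy) c (x, y + t *: dy)).
    under eq_fun do rewrite line; rewrite line; apply: is_derive_line.
    by rewrite -line; apply: dc => //=; exact: X2s.
  exact: is_deriveB.
have dFo (t : R) : t \in `]0, 1[ -> is_derive t 1 F (dF t).
  by move=> t01; apply: dFP; exact: subset_itv_oo_cc.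
have cF : {within `[0, 1], continuous F}.
  by apply: derivable_within_continuous => t /dFP[].
have [t] := MVT_segment (@ler01 R) dFo cF.
rewrite in_itv /= => /andP[t0 t1].
rewrite /F /dF scale1r scale0r addr0 subr0 mulr1 => FE.
have Xt := X2s t t0 t1.
(* [psi] equals ['D_(0, dy) c] wherever [c] is differentiable; in this form it can be differentiated
   again term by term, into entries of [D2xy]. *)
pose psi : Y -> R := \sum_j (dy 0 j *: 'D_(0, delta_mx 0 j) c).
have psiE z : psi z = \sum_j dy 0 j * 'D_(0, delta_mx 0 j) c z.
  by rewrite /psi fct_sumE.
have dpsi z : X1 z.1 -> X2 z.2 -> differentiable psi z.
  by move=> z1 z2; apply: differentiable_sum => j; apply: differentiableZ; exact: dDc.
have line2 s : (x + s *: dx, y + t *: dy) = (x, y + t *: dy) + s *: (dx, 0) :> Y.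
  by congr pair; rewrite /= scaler0 addr0.
have [s|s [s0 s1 sE]] := @line_MVT R Y psi (x, y + t *: dy) (dx, 0).
  by move=> s0 s1; rewrite -line2; apply: dpsi => //=; exact: X1s.
exists s, t; split; [exact/andP|exact/andP|].
have -> : c (x', y') + c (x, y) - (c (x, y') + c (x', y)) =
    c (x', y + dy) - c (x, y + dy) - (c (x', y) - c (x, y)).
  by rewrite /dy subrKC; ring.
have Xs := X1s s s0 s1.
rewrite FE !derive_coord2; [|exact: dc|exact: dc].
rewrite -!psiE.
have <- : (x, y + t *: dy) + (dx, 0) = (x', y + t *: dy) :> Y.
  by congr pair; rewrite /= ?addr0 // /dx subrKC.
rewrite sE -line2 derive_coord1; last exact: dpsi.
apply: eq_bigr => i _; congr (_ * _).
rewrite /psi derive_sum; last first.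
  by move=> j; apply: derivableZ; apply: diff_derivable; exact: dDc.
apply: eq_bigr => j _; rewrite deriveZ; last by apply: diff_derivable; exact: dDc.
by rewrite /D2xy [X in _ = _ * X]mxE.
Qed.
End mixed.

(** * Local Lipschitz estimate *)

Section linear_estimates.
Context {R : realType} {d : nat}.
Local Notation V := 'rV[R]_d.
Implicit Types (u v w : V) (M A D : 'M[R]_d).

Lemma enorm_ge0 v : 0 <= enorm v. Proof. exact: sqrtr_ge0. Qed.

Lemma coord_le_enorm v i : `|v 0 i| <= enorm v.
Proof.
rewrite -sqrtr_sqr ler_wsqrtr // (bigD1 i) //= lerDl sumr_ge0 // => j _.
exact: sqr_ge0.
Qed.

Lemma enorm_le_coord v (a : R) : 0 <= a -> (forall i, `|v 0 i| <= a) ->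
  enorm v <= d%:R * a.
Proof.
move=> a0 va; rewrite -ler_sqr ?nnegrE ?enorm_ge0 ?mulr_ge0 //.
rewrite enorm_sqr; apply: (@le_trans _ _ (\sum_(i < d) a ^+ 2)).
  by apply: ler_sum => i _; rewrite -real_normK ?num_real // ler_sqr ?nnegrE.
rewrite sumr_const card_ord -[leLHS]mulr_natl exprMn ler_wpM2r ?sqr_ge0 //.
by rewrite -natrX ler_nat; case: (d) => // k; rewrite expnS leq_pmulr ?expn_gt0.
Qed.

Lemma enormZ (a : R) v : enorm (a *: v) = `|a| * enorm v.
Proof.
rewrite /enorm -sqrtr_sqr -sqrtrM ?sqr_ge0 // mulr_sumr; congr Num.sqrt.
by apply: eq_bigr => i _; rewrite mxE exprMn.
Qed.

Lemma enorm_eq0 v : enorm v = 0 -> v = 0.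
Proof.
move=> v0; apply/rowP => i; apply/eqP; rewrite mxE -normr_le0 -v0.
exact: coord_le_enorm.
Qed.

Lemma opnorm_ub M w : enorm w <= 1 -> enorm (w *m M^T) <= opnorm M.
Proof.
move=> w1; apply: sup_ubound; last by exists w.
(* The supremum that defines [opnorm] is an upper bound only for a bounded set; the entries of [M]
   provide the bound. *)
exists (d%:R * \sum_i \sum_j `|M i j|) => _ [{w1}w /= w1 <-].
apply: enorm_le_coord => [|i]; first by do 2! apply: sumr_ge0 => ? _.
rewrite mxE; apply: le_trans (ler_norm_sum _ _ _) _.
rewrite [leRHS](bigD1 i) //= ler_wpDr //.
  by do 2! apply: sumr_ge0 => ? _.
apply: ler_sum => j _; rewrite mxE normrM ler_piMl //.
exact: le_trans (coord_le_enorm _ _) w1.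
Qed.

Lemma opnorm_ge0 M : 0 <= opnorm M.
Proof.
have e0 : enorm (0 : V) = 0 by rewrite -[0](scale0r 0) enormZ normr0 mul0r.
by have := @opnorm_ub M 0; rewrite mul0mx e0; apply.
Qed.

Lemma opnormP M v : enorm (v *m M^T) <= opnorm M * enorm v.
Proof.
have [v0|v0] := eqVneq (enorm v) 0.
  by rewrite v0 mulr0 (enorm_eq0 v0) mul0mx -[X in enorm X](scale0r 0) enormZ normr0 mul0r.
have vp : 0 < enorm v by rewrite lt_neqAle eq_sym v0 enorm_ge0.
rewrite -ler_pdivrMr //.
have -> : enorm (v *m M^T) / enorm v = enorm (((enorm v)^-1 *: v) *m M^T).
  by rewrite -scalemxAl enormZ ger0_norm ?invr_ge0 ?enorm_ge0 // mulrC.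
apply: opnorm_ub.
by rewrite enormZ ger0_norm ?invr_ge0 ?enorm_ge0 // mulVf.
Qed.

Lemma sqr_enormB u w :
  enorm (u - w) ^+ 2 = enorm u ^+ 2 + enorm w ^+ 2 - 2 * \sum_i u 0 i * w 0 i.
Proof.
rewrite !enorm_sqr mulr_sumr -big_split -sumrB /=; apply: eq_bigr => i _.
by rewrite !mxE; ring.
Qed.

(** Put [w = A v]. Then [u . w = u . D v + u . (A - D) v], where the first term is nonpositive and
    the second is at most [d^2 e K |u| |w| <= |u| |w| / 2]. Hence
    [|u|^2 + |w|^2 - |u| |w| <= |u - w|^2], which controls both [|u|] and [|w|], and [v] is
    recovered from [w] through [invmx A]. *)
Lemma monotone_pair_bound A D u v (K e : R) :
  A \in unitmx -> opnorm (invmx A) <= K ->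
  (forall i j, `|A i j - D i j| <= e) -> d%:R ^+ 2 * e * K <= 2^-1 ->
  \sum_i u 0 i * \sum_j v 0 j * D i j <= 0 ->
  enorm u <= 2 * enorm (u - v *m A^T) /\
  enorm v <= K * (2 * enorm (u - v *m A^T)).
Proof.
move=> uA iA AD eK uDv; set w := v *m A^T; set p := enorm (u - w).
have K0 : 0 <= K by apply: le_trans iA; exact: opnorm_ge0.
have vK : enorm v <= K * enorm w.
  have -> : v = w *m (invmx A)^T.
    by rewrite /w -mulmxA -trmx_mul mulVmx // trmx1 mulmx1.
  by apply: le_trans (opnormP _ _) _; rewrite ler_wpM2r ?enorm_ge0.
have uw : \sum_i u 0 i * w 0 i <= 2^-1 * (enorm u * enorm w).
  have -> : \sum_i u 0 i * w 0 i = \sum_i u 0 i * (\sum_j v 0 j * D i j) +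
      \sum_i \sum_j u 0 i * v 0 j * (A i j - D i j).
    rewrite -big_split /=; apply: eq_bigr => i _.
    rewrite !mxE !mulr_sumr -big_split /=; apply: eq_bigr => j _.
    by rewrite mxE; ring.
  rewrite -[leRHS]add0r lerD //.
  apply: (@le_trans _ _ (\sum_(i < d) \sum_(j < d) (enorm u * (K * enorm w) * e))).
    apply: ler_sum => i _; apply: ler_sum => j _.
    apply: le_trans (ler_norm _) _; rewrite !normrM.
    rewrite ler_pM ?mulr_ge0 //; apply: ler_pM => //; first exact: coord_le_enorm.
    exact: le_trans (coord_le_enorm _ _) vK.
  rewrite !sumr_const !card_ord -mulrnA -[leLHS]mulr_natl natrM.
  rewrite (_ : _ * _ = d%:R ^+ 2 * e * K * (enorm u * enorm w)); last by ring.
  by rewrite ler_wpM2r // mulr_ge0 ?enorm_ge0.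
have pE := sqr_enormB u w; rewrite -/p in pE.
have p0 : 0 <= p by exact: enorm_ge0.
(* Here [a^2 + b^2 - a b = (b - a / 2)^2 + 3 a^2 / 4]. *)
have bound (a b : R) : 0 <= a -> 0 <= b ->
    a ^+ 2 + b ^+ 2 - a * b <= p ^+ 2 -> a <= 2 * p.
  by move=> a0 b0 ab; rewrite -ler_sqr ?nnegrE ?mulr_ge0 //; nra.
have uwp : enorm u ^+ 2 + enorm w ^+ 2 - enorm u * enorm w <= p ^+ 2.
  by rewrite pE; lra.
split; first exact: bound (enorm_ge0 u) (enorm_ge0 w) uwp.
apply: le_trans vK _; rewrite ler_wpM2l //.
by apply: bound (enorm_ge0 w) (enorm_ge0 u) _; lra.
Qed.
End linear_estimates.

Section local_estimate.
Context {R : realType} {d : nat}.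
Local Notation V := 'rV[R]_d.
Local Notation Y := (V * V)%type.

Definition coords_le (h : R) (z z' : Y) :=
  forall i, `|z.1 0 i - z'.1 0 i| <= h /\ `|z.2 0 i - z'.2 0 i| <= h.

Lemma unif_continuous_coords (X : set Y) (D : Y -> 'M[R]_d) (e : R) :
  unif_continuous (D : subspace X -> 'M[R]_d) -> 0 < e ->
  exists2 h : R, 0 < h & forall z z', X z -> X z' -> coords_le h z z' ->
    forall i j, `|D z i j - D z' i j| <= e.
Proof.
move=> uD e0.
have entE : entourage [set AB : 'M[R]_d * 'M[R]_d | ball AB.1 e AB.2].
  by rewrite -entourage_ballE; exists e.
have [E entE' ED] := uD _ entE.
move: entE'; rewrite -entourage_ballE => -[h /= h0 hE].
(* Half of the modulus: [coords_le] is a non-strict bound, whereas balls are open. *)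
have h20 : 0 < h / 2 by rewrite divr_gt0.
exists (h / 2) => // z z' Xz Xz' zz' i j.
have : ball (D z) e (D z').
  apply: (ED (z, z')); right; split=> //; split=> //; apply: hE.
  have h2 : h / 2 < h by lra.
  by split; split=> // k l; rewrite (ord1 k); apply: le_lt_trans h2;
    have [] := zz' l.
by case=> _ /(_ i j) /ltW.
Qed.

Variables (X1 X2 : set V) (c : Y -> R).
Hypotheses (X1_convex : convex_set X1) (X2_convex : convex_set X2).
Hypotheses (c_C2 : C2 (X1 `*` X2) c) (c_nondeg : nondegenerate_on (X1 `*` X2) c).
Hypothesis c_unif : unif_continuous (D2xy c : subspace (X1 `*` X2) -> 'M[R]_d).
Hypothesis c_inv_bound : opnorm_bounded_on (X1 `*` X2) (fun z => invmx (D2xy c z)).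

(** By [mixed_MVT], an uncrossed pair satisfies the sign condition of [monotone_pair_bound] for the
    mixed Hessian at an intermediate point. Uniform continuity makes this matrix close to the one at
    [z0], on a scale that is the same for all [z0]. *)
Lemma not_crossed_local_bound : exists2 hL : R * R, 0 < hL.1 /\ 0 <= hL.2 &
  forall z0 z z', (X1 `*` X2) z0 -> (X1 `*` X2) z -> (X1 `*` X2) z' ->
    coords_le hL.1 z0 z -> coords_le hL.1 z z' -> ~~ crossed c (z, z') ->
    penorm (z - z') <=
      hL.2 * enorm ((z - z').1 - (z - z').2 *m (D2xy c z0)^T).
Proof.
(* The given bound may be negative if [X1]*[X2] is empty. *)
have [K0 K0P] := c_inv_bound; pose K := Num.max K0 0.
have K_ge0 : 0 <= K by rewrite le_max lexx orbT.
have KP z : (X1 `*` X2) z -> opnorm (invmx (D2xy c z)) <= K.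
  by move=> /K0P /le_trans; apply; rewrite le_max lexx.
(* Chosen so that [d^2 e K <= 1/2]; the [+ 1] keeps the denominator positive. *)
pose e := (2 * (d%:R ^+ 2 * K + 1))^-1.
have dK0 : 0 < d%:R ^+ 2 * K + 1 by rewrite ltr_wpDl // mulr_ge0 // sqr_ge0.
have e0 : 0 < e by rewrite invr_gt0 mulr_gt0.
have [h h0 hP] := unif_continuous_coords c_unif e0.
(* Scale [h / 2], because the intermediate point is reached from [z0] in two moves, to [z] and then
   towards [z']. Factor [2 (1 + K)], because [(2 p)^2 + (2 K p)^2 <= (2 (1 + K) p)^2]. *)
exists (h / 2, 2 * (1 + K)); first by rewrite /= divr_gt0 // mulr_ge0 // addr_ge0.
move=> z0 z z' Xz0 Xz Xz' /= z0z zz' nc.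
case: z z' Xz Xz' z0z zz' nc => [x y] [x' y'] [/= Xx Xy] [/= Xx' Xy'] z0z zz'.
rewrite /crossed /= -leNgt => nc.
have [s [t [s01 t01 E]]] := mixed_MVT X1_convex X2_convex c_C2 Xx Xx' Xy Xy'.
move: E; set D := D2xy c _ => E; set A := D2xy c z0.
have Xst : (X1 `*` X2) (x + s *: (x' - x), y + t *: (y' - y)).
  by case/andP: s01 => ? ?; case/andP: t01 => ? ?; split; exact: convex_set_line.
have small (k a b b' : R) : 0 <= k <= 1 -> `|a - b| <= h / 2 ->
    `|b - b'| <= h / 2 -> `|a - (b + k * (b' - b))| <= h.
  move=> /andP[k0 k1] ab bb'.
  rewrite (_ : a - _ = (a - b) + k * (b - b')); last by ring.
  rewrite (splitr h) (le_trans (ler_normD _ _)) // lerD //.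
  by apply: le_trans bb'; rewrite normrM ger0_norm // ler_piMl.
have AD i j : `|A i j - D i j| <= e.
  apply: hP => // k; have [/= a1 a2] := z0z k; have [/= b1 b2] := zz' k.
  by split; rewrite /= !mxE; exact: small.
have eK : d%:R ^+ 2 * e * K <= 2^-1.
  by rewrite mulrAC /e invfM mulrCA ler_piMr // ler_pdivrMr // mul1r lerDl.
have uvD : \sum_i (x' - x) 0 i * \sum_j (y' - y) 0 j * D i j <= 0.
  by rewrite -E subr_le0 [c (x', y') + _]addrC.
have [B1 B2] := monotone_pair_bound (c_nondeg Xz0) (KP _ Xz0) AD eK uvD.
rewrite -penormN opprB /=.
have -> : x - x' - (y - y') *m A^T = - (x' - x - (y' - y) *m A^T).
  by rewrite -(opprB y') mulNmx opprK [RHS]opprB [RHS]addrC -[in RHS](opprB x x') opprK.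
rewrite enormN; rewrite -/A in B1 B2; set p := enorm (_ - _ *m A^T) in B1 B2 *.
have p0 : 0 <= p by exact: enorm_ge0.
rewrite -ler_sqr ?nnegrE ?mulr_ge0 ?addr_ge0 ?sqrtr_ge0 // penorm_sqr /=.
have H1 : enorm (x' - x) ^+ 2 <= (2 * p) ^+ 2.
  by rewrite ler_sqr ?nnegrE ?mulr_ge0 ?enorm_ge0.
have H2 : enorm (y' - y) ^+ 2 <= (K * (2 * p)) ^+ 2.
  by rewrite ler_sqr ?nnegrE ?mulr_ge0 ?enorm_ge0.
apply: le_trans (lerD H1 H2) _.
have KK : 0 <= K * p ^+ 2 by rewrite mulr_ge0 ?sqr_ge0.
nra.
Qed.
End local_estimate.

(** * Covering by small cells *)

(** The index is the integer part of [(t + a) / w], which is at most that of [2 * a / w]; the [.+1]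
    counts the index [0]. *)
Lemma grid_cell (R : realType) (a w t : R) : 0 < w -> `|t| <= a ->
  exists k : 'I_(Num.truncn (2 * a / w)).+1,
    -a + k%:R * w <= t <= - a + k.+1%:R * w.
Proof.
move=> w0 ta; have := ta; rewrite ler_norml => /andP[ta1 ta2].
have k0 : 0 <= (t + a) / w by rewrite divr_ge0 ?(ltW w0) // -lerBlDr sub0r.
have kle : (Num.truncn ((t + a) / w) < (Num.truncn (2 * a / w)).+1)%N.
  by rewrite ltnS; apply: le_truncn; rewrite ler_pM2r ?invr_gt0 //; lra.
exists (Ordinal kle) => /=; apply/andP; split.
  have := truncn_le ((t + a) / w); rewrite k0 ler_pdivlMr //; lra.
have := truncnS_gt ((t + a) / w); rewrite ltr_pdivrMr //; lra.
Qed.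

Lemma cell_dist (R : realType) (a w t t' : R) (k : nat) :
  a + k%:R * w <= t <= a + k.+1%:R * w ->
  a + k%:R * w <= t' <= a + k.+1%:R * w -> `|t - t'| <= w.
Proof. by rewrite -natr1 ler_norml => /andP[? ?] /andP[? ?]; apply/andP; split; lra. Qed.

Lemma measurable_slab d (T : measurableType d) (R : realType) (n : nat)
    (f : 'I_n -> T -> R) (a b : 'I_n -> R) :
  (forall i, measurable_fun setT (f i)) ->
  measurable [set z | forall i, a i <= f i z <= b i].
Proof.
move=> mf; rewrite (_ : [set z | _] =
    \bigcap_(i in [set: 'I_n]) (f i @^-1` `[a i, b i])).
  apply: fin_bigcap_measurable => [|i _]; first exact: finite_finset.
  by rewrite -[X in measurable X]setTI; exact: mf.
apply/seteqP; split=> z /= h i; first by move=> _; rewrite /= in_itv /=; exact: h.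
by have := h i Logic.I; rewrite /= in_itv.
Qed.

Section cells.
Context {R : realType} {d : nat}.
Local Notation V := 'rV[R]_d.
Local Notation Y := (V * V)%type.
Variables (X : set Y) (N : set (Y * Y)) (D : Y -> 'M[R]_d) (K L h r s : R).
Hypotheses (L_ge0 : 0 <= L) (h_gt0 : 0 < h) (s_gt0 : 0 < s).
Hypothesis D_bound : forall z, X z -> opnorm (D z) <= K.
Hypothesis close : forall z0 z z', X z0 -> X z -> X z' ->
  coords_le h z0 z -> coords_le h z z' -> ~ N (z, z') ->
  penorm (z - z') <= L * enorm ((z - z').1 - (z - z').2 *m (D z0)^T).

(** Bounds the coordinates of [u - D v] when those of [u] and [v] are at most [h] and [D] has norm
    at most [K]. *)
Let H := h + K * (d%:R * h).
Let box := ({ffun 'I_d -> 'I_(Num.truncn (2 * r / h)).+1} *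
   {ffun 'I_d -> 'I_(Num.truncn (2 * r / h)).+1})%type.
Definition cell_index : finType :=
  (box * {ffun 'I_d -> 'I_(Num.truncn (2 * H / s)).+1})%type.

Let Q (b : box) : set Y :=
  [set z : Y | forall i, - r + (b.1 i)%:R * h <= z.1 0 i <= - r + (b.1 i).+1%:R * h] `&`
  [set z : Y | forall i, - r + (b.2 i)%:R * h <= z.2 0 i <= - r + (b.2 i).+1%:R * h].
(** The point at which the mixed Hessian is frozen on the cube; the default [0] occurs only for
    cubes that miss [X]. *)
Let z0 b := xget 0 (Q b `&` X).
(** The map [x - A y] with [A = D (z0 b)], recentred at [z0 b] so that the same bound [H] serves
    every cube that meets [X]. *)
Let phi b (z : Y) : V := (z - z0 b).1 - (z - z0 b).2 *m (D (z0 b))^T.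
Let P (k : cell_index) := Q k.1 `&` [set z : Y | forall i,
  - H + (k.2 i)%:R * s <= phi k.1 z 0 i <= - H + (k.2 i).+1%:R * s].

Let mP k : measurable (P k).
Proof.
apply: measurableI; first apply: measurableI.
- exact: (measurable_slab (f := fun i (z : Y) => z.1 0 i)) (@measurable_coord1 R d).
- exact: (measurable_slab (f := fun i (z : Y) => z.2 0 i)) (@measurable_coord2 R d).
apply: (measurable_slab (f := fun i z => phi k.1 z 0 i)) => i.
under eq_fun do rewrite !mxE.
apply: measurable_funB; first by apply: measurable_funB => //; exact: measurable_coord1.
apply: measurable_sum => j; under eq_fun do rewrite !mxE.
by apply: measurable_funM => //; apply: measurable_funB => //; exact: measurable_coord2.
Qed.

Let Q_coords b z z' : Q b z -> Q b z' -> coords_le h z z'.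
Proof.
by move=> [z1 z2] [z'1 z'2] i; split; apply: cell_dist; [exact: z1|exact: z'1|exact: z2|exact: z'2].
Qed.

Let z0P b z : X z -> Q b z -> X (z0 b) /\ Q b (z0 b).
Proof. by move=> Xz Qz; have [] := @xgetPex _ 0 (Q b `&` X) (ex_intro _ z (conj Qz Xz)). Qed.

(** By linearity the right-hand side of [close] involves only [phi k.1 z - phi k.1 z'], whose
    coordinates are at most [s] within a cell. *)
Let P_close k z z' : X z -> X z' -> P k z -> P k z' -> ~ N (z, z') ->
  penorm (z - z') <= L * (d%:R * s).
Proof.
move=> Xz Xz' [Qz Pz] [Qz' Pz'] Nz; have [X0 Q0] := z0P Xz Qz.
have := close X0 Xz Xz' (Q_coords Q0 Qz) (Q_coords Qz Qz') Nz.
move=> /le_trans; apply; rewrite ler_wpM2l //.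
apply: enorm_le_coord => [|i]; first exact: ltW.
rewrite (_ : _ - _ = phi k.1 z - phi k.1 z'); last first.
  rewrite /phi /=; set A := (D _)^T; rewrite !mulmxBl.
  move: (z.2 *m A) (z'.2 *m A) ((z0 k.1).2 *m A) => a b e.
  by apply/rowP => j; rewrite !mxE; ring.
rewrite mxE [(- phi k.1 z') _ _]mxE.
by apply: cell_dist; [exact: Pz|exact: Pz'].
Qed.

(** If the norm is below [r], all coordinates lie in [[-r, r]], which places [z] in a cube; there
    the coordinates of [phi] lie in [[-H, H]], which selects the slabs. *)
Let P_cover z : X z -> (forall k, ~ P k z) -> r <= penorm z.
Proof.
move=> Xz nP; rewrite leNgt; apply/negP => zr.
have z1r i : `|z.1 0 i| <= r.
  apply: le_trans (coord_le_enorm _ _) _; apply: le_trans (ltW zr).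
  rewrite -ler_sqr ?nnegrE ?enorm_ge0 ?sqrtr_ge0 // penorm_sqr lerDl.
  exact: sqr_ge0.
have z2r i : `|z.2 0 i| <= r.
  apply: le_trans (coord_le_enorm _ _) _; apply: le_trans (ltW zr).
  rewrite -ler_sqr ?nnegrE ?enorm_ge0 ?sqrtr_ge0 // penorm_sqr lerDr.
  exact: sqr_ge0.
have [k1 k1P] := fin_all_exists (fun i => grid_cell h_gt0 (z1r i)).
have [k2 k2P] := fin_all_exists (fun i => grid_cell h_gt0 (z2r i)).
pose b : box := ([ffun i => k1 i], [ffun i => k2 i]).
have Qz : Q b z by split=> i; rewrite /= ffunE; [exact: k1P|exact: k2P].
have [X0 Q0] := z0P Xz Qz.
have phiH i : `|phi b z 0 i| <= H.
  have zz0 := Q_coords Qz Q0.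
  rewrite /phi mxE [(- (_ *m _)) _ _]mxE; apply: le_trans (ler_normB _ _) _.
  rewrite lerD //; first by have [] := zz0 i; rewrite /= !mxE.
  apply: le_trans (coord_le_enorm _ _) _; apply: le_trans (opnormP _ _) _.
  rewrite ler_pM ?opnorm_ge0 ?enorm_ge0 ?D_bound //.
  apply: enorm_le_coord => [|j]; first exact: ltW.
  by have [] := zz0 j; rewrite /= !mxE.
have [k3 k3P] := fin_all_exists (fun i => grid_cell s_gt0 (phiH i)).
by apply: (nP (b, [ffun i => k3 i])); split=> //= i; rewrite ffunE; exact: k3P.
Qed.

Lemma cell_cover : exists P : cell_index -> set Y,
  [/\ forall k, measurable (P k),
      forall k z z', X z -> X z' -> P k z -> P k z' -> ~ N (z, z') ->
        penorm (z - z') <= L * (d%:R * s) &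
      forall z, X z -> (forall k, ~ P k z) -> r <= penorm z].
Proof. by exists P; split; [exact: mP|exact: P_close|exact: P_cover]. Qed.
End cells.

(** * Moments *)

Lemma probability1I d (T : measurableType d) (R : realType)
    (pi : probability T R) (A B : set T) : measurable A -> measurable B ->
  (pi A = 1 -> pi B = 1 -> pi (A `&` B) = 1)%E.
Proof.
move=> mA mB A1 B1; rewrite -[A `&` B]setCK setCI.
rewrite probability_setC; last by apply: measurableU; exact: measurableC.
have C0 C : measurable C -> pi C = 1%E -> pi (~` C) = 0%E.
  by move=> mC C1; rewrite probability_setC // C1 subee.
rewrite measureU0; [|exact: measurableC|exact: measurableC|exact: C0].
by rewrite [X in (_ - X)%E](C0 A mA A1) sube0.
Qed.

Section marginals.
Context d1 d2 (T1 : measurableType d1) (T2 : measurableType d2) (R : realType).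
Variables (mu1 : probability T1 R) (mu2 : probability T2 R).
Variable pi : probability (T1 * T2)%type R.
Hypothesis cpi : couplings mu1 mu2 pi.
Local Open Scope ereal_scope.

Lemma integral_marginal1 (f : T1 -> \bar R) : measurable_fun setT f ->
  (forall x, 0 <= f x) -> \int[pi]_z f z.1 = \int[mu1]_x f x.
Proof.
move=> mf f0.
rewrite -(@ge0_integral_pushforward _ _ _ _ _ _ measurable_fst pi setT f) //.
apply: eq_measure_integral => A mA _; have [/(_ A mA) piA _] := cpi; apply: etrans piA.
by congr (pi _); apply/seteqP; split=> [z|z []].
Qed.

Lemma integral_marginal2 (f : T2 -> \bar R) : measurable_fun setT f ->
  (forall x, 0 <= f x) -> \int[pi]_z f z.2 = \int[mu2]_x f x.
Proof.
move=> mf f0.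
rewrite -(@ge0_integral_pushforward _ _ _ _ _ _ measurable_snd pi setT f) //.
apply: eq_measure_integral => A mA _; have [_ /(_ A mA) piA] := cpi; apply: etrans piA.
by congr (pi _); apply/seteqP; split=> [z|z []].
Qed.

Lemma couplings_setX (A : set T1) (B : set T2) : measurable A -> measurable B ->
  mu1 A = 1 -> mu2 B = 1 -> pi (A `*` B) = 1.
Proof.
move=> mA mB A1 B1; case: cpi => /(_ A mA) piA /(_ B mB) piB.
have mA' : measurable (A `*` [set: T2]) by exact: measurableX.
have mB' : measurable ([set: T1] `*` B) by exact: measurableX.
by rewrite -[A]setIT -[B]setTI setXI; exact: probability1I mA' mB' (etrans piA A1) (etrans piB B1).
Qed.
End marginals.

Section moments.
Context {R : realType} {d : nat}.
Local Notation V := 'rV[R]_d.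
Local Notation Y := (V * V)%type.

Lemma penorm_ge0 (z : Y) : 0 <= penorm z. Proof. exact: sqrtr_ge0. Qed.

Lemma penorm_powR_le (q : R) (z : Y) : 0 <= q ->
  penorm z `^ q <= 2 `^ q * (enorm z.1 `^ q + enorm z.2 `^ q).
Proof.
move=> q0; set a := enorm z.1; set b := enorm z.2.
have a0 : 0 <= a by exact: enorm_ge0.
have b0 : 0 <= b by exact: enorm_ge0.
pose m := Num.max a b.
have am : a <= m by rewrite le_max lexx.
have bm : b <= m by rewrite le_max lexx orbT.
have m0 : 0 <= m by exact: le_trans am.
apply: (@le_trans _ _ ((2 * m) `^ q)).
  rewrite ge0_ler_powR ?nnegrE ?mulr_ge0 ?penorm_ge0 //.
  rewrite -ler_sqr ?nnegrE ?mulr_ge0 ?penorm_ge0 // penorm_sqr -/a -/b; nra.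
rewrite powRM // ler_wpM2l ?powR_ge0 //.
by rewrite /m; case: (leP a b) => _; [rewrite lerDr|rewrite lerDl]; exact: powR_ge0.
Qed.

Lemma couplings_finite_moment (q : R) (mu1 mu2 : probability V R)
    (pi : probability Y R) : 0 <= q ->
  finite_moment enorm q mu1 -> finite_moment enorm q mu2 ->
  couplings mu1 mu2 pi -> finite_moment penorm q pi.
Proof.
move=> q0 f1 f2 cpi; rewrite /finite_moment.
have me : measurable_fun setT (fun x : V => (enorm x `^ q)%:E).
  apply/measurable_EFinP.
  exact: measurableT_comp (measurable_powR q) measurable_enorm.
have me1 : measurable_fun setT (fun x : Y => (enorm x.1 `^ q)%:E).
  exact: measurableT_comp me measurable_fst.
have me2 : measurable_fun setT (fun x : Y => (enorm x.2 `^ q)%:E).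
  exact: measurableT_comp me measurable_snd.
apply: (@le_lt_trans _ _ (\int[pi]_z ((2 `^ q)%:E *
    ((enorm z.1 `^ q)%:E + (enorm z.2 `^ q)%:E)))%E).
  apply: ge0_le_integral => //.
  - by move=> z _; rewrite lee_fin powR_ge0.
  - apply/measurable_EFinP.
    exact: measurableT_comp (measurable_powR q) measurable_penorm.
  - by apply: measurable_funeM; apply: emeasurable_funD.
  by move=> z _; rewrite -EFinD -EFinM lee_fin penorm_powR_le.
have e0 x : (0 <= (enorm (x : V) `^ q)%:E)%E by rewrite lee_fin powR_ge0.
rewrite ge0_integralZl //; last first.
- by move=> z _; rewrite adde_ge0.
- exact: emeasurable_funD.
rewrite ge0_integralD // (integral_marginal1 cpi me e0) (integral_marginal2 cpi me e0).
by rewrite lte_mul_pinfty ?lee_fin ?powR_ge0 // lte_add_pinfty.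
Qed.

(** From [t^p <= 1 + t^q] for [t >= 0], the constant being integrable against a probability. *)
Lemma finite_moment_le (p q : R) (pi : probability Y R) :
  0 <= p -> p <= q -> finite_moment penorm q pi -> finite_moment penorm p pi.
Proof.
move=> p0 pq; rewrite /finite_moment => fq.
have mp t : measurable_fun setT (fun z : Y => (penorm z `^ t)%:E).
  apply/measurable_EFinP.
  exact: measurableT_comp (measurable_powR t) measurable_penorm.
apply: (@le_lt_trans _ _ (\int[pi]_z (1 + (penorm z `^ q)%:E))%E).
  apply: ge0_le_integral => //.
  - by move=> z _; rewrite lee_fin powR_ge0.
  - exact: emeasurable_funD.
  move=> z _; rewrite -EFinD lee_fin; have [z1|z1] := leP (penorm z) 1.
    rewrite ler_wpDr ?powR_ge0 // -[leRHS](_ : 1 `^ p = 1); last by rewrite powR1.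
    by rewrite ge0_ler_powR ?nnegrE ?penorm_ge0.
  by rewrite ler_wpDl // ler_powR // ltW.
rewrite ge0_integralD //; last by move=> z _; rewrite lee_fin powR_ge0.
rewrite integral_cst //; have /= -> := probability_setT pi.
by rewrite mule1 lte_add_pinfty // ltry.
Qed.

(** [c] is continuous on the open set [U], so preimages of open intervals within [U] are open, hence
    in the product sigma-algebra. *)
Lemma C2_measurable (X : set Y) (c : Y -> R) :
  C2 X c -> measurable X -> measurable_fun X c.
Proof.
move=> [U [oU XU cU]] mX.
apply: (@measurable_funS _ _ _ _ U) => //; first exact: open_measurable_prod.
apply: (measurability _ (RGenOpens.measurableE R)) => //.
move=> _ [_ [x [y ->]] <-]; apply: open_measurable_prod.
rewrite openE => z [Uz cz]; apply: filterI.
  exact: open_nbhs_nbhs.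
have [/differentiable_continuous cc _ _] := cU z Uz.
by apply: cc; apply: open_nbhs_nbhs; split=> //; exact: interval_open.
Qed.

Lemma growth2_integrable (X : set Y) (c : Y -> R) (pi : probability Y R) :
  measurable X -> measurable_fun X c -> growth2 X c ->
  finite_moment penorm 2 pi -> pi.-integrable setT (EFin \o (c \_ X)).
Proof.
move=> mX mc [C C0 cC] m2.
have m2E : measurable_fun setT (fun z : Y => penorm z `^ 2).
  exact: measurableT_comp (measurable_powR 2) measurable_penorm.
apply: (@le_integrable _ _ _ pi setT measurableT _
  (fun z => (C%:E * (1 + (penorm z `^ 2)%:E))%E)).
- by apply/measurable_EFinP; apply/(measurable_restrictT _ mX).
- move=> z _ /=; rewrite lee_fin [leRHS]ger0_norm; last first.
    by rewrite mulr_ge0 // addr_ge0 // powR_ge0.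
  rewrite patchE; case: ifPn => [|_].
    by rewrite inE => /cC; rewrite powR_mulrn // penorm_ge0.
  by rewrite normr0 mulr_ge0 // addr_ge0 // powR_ge0.
apply: integrableZl => //; apply: integrableD => //.
  exact: finite_measure_integrable_cst.
apply/integrableP; split; first exact/measurable_EFinP.
by under eq_integral do rewrite gee0_abs ?lee_fin ?powR_ge0 //.
Qed.
End moments.

(** * Rate of quantization *)

Lemma powRN_le (R : realType) (a b t : R) : 0 < a -> a <= b -> 0 <= t ->
  b `^ (- t) <= a `^ (- t).
Proof.
move=> a0 ab t0; have b0 := lt_le_trans a0 ab.
rewrite !powRN lef_pV2 ?posrE ?powR_gt0 //.
by apply: ge0_ler_powR => //; rewrite nnegrE ltW.
Qed.

Lemma powR_expn (R : realType) (x t : R) (k : nat) :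
  (x `^ t) ^+ k = x `^ (t * k%:R).
Proof. by rewrite powRrM powR_mulrn // powR_ge0. Qed.

Section final.
Context {R : realType} {d : nat}.
Local Notation V := 'rV[R]_d.
Local Notation Y := (V * V)%type.

Lemma supported_on_at_most_le (m n : nat) (mu : probability Y R) :
  (m <= n)%N -> supported_on_at_most m mu -> supported_on_at_most n mu.
Proof.
move=> mn [A Am A1]; exists A => //; apply: card_le_trans Am _.
by apply: subset_card_le => k /= /leq_trans; apply.
Qed.

(** A budget of [n >= k] points is spent by applying the hypothesis to [n %/ k], which is at least
    [n / (2 k)]; this costs a constant factor. For [n < k] the point mass at the origin suffices,
    with error the root of the second moment. *)
Lemma quant2_of_multiple (pi : probability Y R) (k : nat) (C a : R) :
  (0 < k)%N -> 0 <= C -> 0 <= a -> finite_moment penorm 2 pi ->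
  (forall n, (1 <= n)%N -> exists2 pin : probability Y R,
    supported_on_at_most (k * n) pin & (W2 pin pi <= (C * n%:R `^ (- a))%:E)%E) ->
  exists2 C' : R, 0 < C' & quant2 C' a pi.
Proof.
move=> k0 C0 a0 m2 H.
have b_fin : (\int[pi]_z (penorm z `^ 2)%:E)%E \is a fin_num.
  by rewrite ge0_fin_numE // integral_ge0 // => z _; rewrite lee_fin powR_ge0.
set b := fine (\int[pi]_z (penorm z `^ 2)%:E)%E.
have b0 : 0 <= b.
  by apply: fine_ge0; apply: integral_ge0 => z _; rewrite lee_fin powR_ge0.
have k2 : 0 < 2 * k%:R :> R by rewrite mulr_gt0 // ltr0n.
(* [C] serves [n >= k], [Num.sqrt b] serves [n < k], and [1] ensures positivity. *)
pose C' := C + Num.sqrt b + 1.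
have C'0 : 0 < C' by rewrite ltr_wpDl // addr_ge0 // sqrtr_ge0.
have C'E n : C' * (2 * k%:R) `^ a * n%:R `^ (- a) = C' * (n%:R / (2 * k%:R)) `^ (- a).
  rewrite [in RHS]powRM ?invr_ge0 ?(ltW k2) // -mulrA; congr (_ * _).
  by rewrite -[X in _ = _ * X `^ _](@powR_inv1 _ (2 * k%:R)) ?(ltW k2) // -powRrM mulN1r opprK mulrC.
exists (C' * (2 * k%:R) `^ a); first by rewrite mulr_gt0 // powR_gt0.
split=> // n n1; rewrite C'E.
have n0 : 0 < n%:R / (2 * k%:R) :> R by rewrite divr_gt0 // ltr0n.
have [nk|kn] := ltnP n k.
  have mT : measurable_fun setT (fun _ : Y => 0 : Y) by exact: measurable_cst.
  have [pin pinE] := @pushforward_probability _ _ _ _ _ pi _ mT.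
  exists pin.
    exists ((fun _ : unit => 0 : Y) @` [set: unit]).
      apply: card_le_trans (card_range_finType _) _; rewrite card_unit.
      by apply: subset_card_le => i /=; case: i => //; rewrite ltnS.
    rewrite pinE /pushforward (_ : _ @^-1` _ = setT); first exact: probability_setT.
    by apply/seteqP; split=> // z _; exists tt.
  apply: (@le_trans _ _ (Num.sqrt b)%:E).
    apply: (W2_pushforward mT pinE); first exact: sqrtr_ge0.
    rewrite sqr_sqrtr // fineK // le_eqVlt; apply/orP; left; apply/eqP.
    by apply: eq_integral => z _; rewrite sub0r penormN powR_mulrn // penorm_ge0.
  rewrite lee_fin; apply: (@le_trans _ _ (C' * 1)).
    by rewrite mulr1 /C'; lra.
  rewrite ler_wpM2l ?(ltW C'0) //.
  apply: (@le_trans _ _ (1 `^ (- a))); first by rewrite powR1.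
  apply: powRN_le => //; rewrite ler_pdivrMr // mul1r.
  by rewrite -natrM ler_nat; lia.
have nk0 : (1 <= n %/ k)%N by rewrite divn_gt0.
have [pin pin1 pin2] := H _ nk0; exists pin.
  by apply: supported_on_at_most_le pin1; rewrite mulnC leq_divM.
apply: le_trans pin2 _; rewrite lee_fin; apply: ler_pM.
- by [].
- exact: powR_ge0.
- by rewrite /C'; have := sqrtr_ge0 b; lra.
apply: powRN_le => //; rewrite ler_pdivrMr //.
rewrite -!natrM ler_nat.
have := ltn_ceil n k0; nia.
Qed.
Lemma card_cell_index (K h : R) : 0 <= K -> 0 < h ->
  exists2 k : nat, (0 < k)%N & forall (r s : R) (n : nat), 1 <= r ->
    0 < s -> s <= 1 -> (1 <= n)%N ->
    r ^+ d * r ^+ d * s^-1 ^+ d = n%:R ->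
    (#|cell_index (d := d) K h r s|.+1 <= k * n)%N.
Proof.
move=> K0 h0; pose H := h + K * (d%:R * h).
have H0 : 0 <= H by rewrite addr_ge0 ?mulr_ge0 // ltW.
have bound (t : R) : 0 <= t -> (Num.truncn t).+1%:R <= t + 1.
  by move=> t0; rewrite -natr1 lerD2r; have := truncn_le t; rewrite t0.
pose a := 2 / h + 1; pose b := 2 * H + 1.
have a0 : 0 <= a by rewrite addr_ge0 // divr_ge0 // ltW.
have b0 : 0 <= b by rewrite addr_ge0 // mulr_ge0.
pose k0 := a ^+ d * a ^+ d * b ^+ d.
have k00 : 0 <= k0 by rewrite !mulr_ge0 // exprn_ge0.
(* The number of cells is at most [k0 * n], where [1 <= r] and [1 <= s^-1] absorb the rounding of
   each factor. One [.+1] dominates the fractional part of [k0], the other pays for the extra point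
   of the quantizer. *)
exists (Num.truncn k0).+2 => // r s n r1 s0 s1 n1 rsn.
have r0 : 0 <= r by apply: le_trans r1.
have m_le : (Num.truncn (2 * r / h)).+1%:R <= a * r.
  apply: le_trans (bound _ _) _; first by rewrite divr_ge0 ?mulr_ge0 // ltW.
  by rewrite /a [leRHS]mulrDl mul1r mulrAC lerD2l.
have l_le : (Num.truncn (2 * H / s)).+1%:R <= b * s^-1.
  apply: le_trans (bound _ _) _; first by rewrite divr_ge0 ?mulr_ge0 // ltW.
  by rewrite /b [leRHS]mulrDl mul1r lerD2l invf_ge1.
rewrite -(ler_nat R) !card_prod !card_ffun !card_ord natrM -natr1 !natrM !natrX.
have nE : k0 * n%:R = (a * r) ^+ d * (a * r) ^+ d * (b * s^-1) ^+ d.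
  by rewrite -rsn /k0 !exprMn; ring.
apply: (@le_trans _ _ (k0 * n%:R + 1)).
  rewrite lerD2r nE; apply: ler_pM; rewrite ?mulr_ge0 ?exprn_ge0 //.
    by apply: ler_pM; rewrite ?exprn_ge0 //; apply: lerXn2r; rewrite ?nnegrE ?mulr_ge0.
  by apply: lerXn2r; rewrite ?nnegrE ?mulr_ge0 ?invr_ge0 // ltW.
have : k0 < (Num.truncn k0).+1%:R by exact: truncnS_gt.
have : 1 <= n%:R :> R by rewrite (ler_nat R 1).
rewrite -(natr1 (_.+1)) => nn kk; nra.
Qed.
End final.

(** * Choice of the parameters and conclusion *)

Unset Implicit Arguments.

Theorem lemma3p16 (R : realType) (d : nat) (hd : (0 < d)%N)
  (X1 X2 : set 'rV[R]_d)
  (X1_closed : closed X1) (X1_convex : convex_set X1)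
  (X2_closed : closed X2) (X2_convex : convex_set X2)
  (c : 'rV[R]_d * 'rV[R]_d -> R)
  (c_C2 : C2 (X1 `*` X2) c)
  (c_nondeg : nondegenerate_on (X1 `*` X2) c)
  (c_growth : growth2 (X1 `*` X2) c)
  (c_unif : unif_continuous (D2xy c : subspace (X1 `*` X2) -> 'M[R]_d))
  (c_bound : opnorm_bounded_on (X1 `*` X2) (D2xy c))
  (c_inv_bound : opnorm_bounded_on (X1 `*` X2) (fun z => invmx (D2xy c z)))
  (d' : R) (hd' : d%:R < d')
  (mu1 mu2 : probability 'rV[R]_d R)
  (mu1_X1 : mu1 X1 = 1%E) (mu2_X2 : mu2 X2 = 1%E)
  (mu1_moment : finite_moment enorm (2 * ((d' + d%:R) / (d' - d%:R))) mu1)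
  (mu2_moment : finite_moment enorm (2 * ((d' + d%:R) / (d' - d%:R))) mu2) :
  forall pi : probability ('rV[R]_d * 'rV[R]_d)%type R,
    optimal_transport (X1 `*` X2) c mu1 mu2 pi ->
    exists2 C : R, 0 < C & quant2 C (1 / d') pi.
Proof.
move=> pi [cpi opt]; set X := X1 `*` X2.
have mX1 : measurable X1 by exact: closed_measurable_rV.
have mX2 : measurable X2 by exact: closed_measurable_rV.
have mX : measurable X by exact: measurableX.
have piX : pi X = 1%E.
  by have := couplings_setX cpi mX1 mX2 mu1_X1 mu2_X2; apply.
have d0 : (0 : R) < d%:R by rewrite ltr0n.
have d'0 : 0 < d' by exact: lt_trans hd'.
have dd' : 0 < d' - d%:R by rewrite subr_gt0.
set q := 2 * ((d' + d%:R) / (d' - d%:R)) in mu1_moment mu2_moment.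
have q2 : 2 <= q by rewrite /q ler_peMr // ler_pdivlMr // mul1r; lra.
have q0 : 0 <= q by exact: le_trans q2.
have moment_q pi' (c' : couplings mu1 mu2 pi') : finite_moment penorm q pi'.
  exact: couplings_finite_moment q0 mu1_moment mu2_moment c'.
have moment_2 pi' (c' : couplings mu1 mu2 pi') : finite_moment penorm 2 pi'.
  by apply: (finite_moment_le _ q2 (moment_q pi' c')).
have mc : measurable_fun X c by exact: C2_measurable.
(* Extension by zero gives a cost that is measurable on the whole space and has the same integral
   over [X] for every coupling. *)
pose g := c \_ X.
have mg : measurable_fun setT g by apply/(measurable_restrictT _ mX).
have ig pi' : couplings mu1 mu2 pi' -> pi'.-integrable setT (EFin \o g).
  by move=> c'; apply: growth2_integrable => //; exact: moment_2.
have gE (pi' : probability _ R) :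
    (\int[pi']_(z in X) (c z)%:E = \int[pi']_z (g z)%:E)%E.
  rewrite integral_mkcond; apply: eq_integral => z _.
  by rewrite /g !patchE; case: ifP.
have optg pi' : couplings mu1 mu2 pi' ->
    (\int[pi]_z (g z)%:E <= \int[pi']_z (g z)%:E)%E.
  by rewrite -!gE; exact: opt.
have N0 := optimal_not_crossed mg cpi ig optg.
set N := [set w | crossed g w] in N0.
have mN : measurable N.
  rewrite (_ : N = crossed g @^-1` [set true]) // -[X in measurable X]setTI.
  exact: measurable_crossed.
(* As [X] is a product, it also contains the two exchanged points. *)
have crossedE z z' : X z -> X z' -> crossed g (z, z') = crossed c (z, z').
  move=> [z1 z2] [z1' z2']; rewrite /crossed /g !patchE /=.
  by rewrite !ifT // inE; split.
have [[h L] /= [h0 L0] close] := not_crossed_local_bound X1_convex X2_convex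
  c_C2 c_nondeg c_unif c_inv_bound.
have [K0 K0P] := c_bound; pose K := Num.max K0 0.
have K_ge0 : 0 <= K by rewrite le_max lexx orbT.
have KP z : X z -> opnorm (D2xy c z) <= K.
  by move=> /K0P /le_trans; apply; rewrite le_max lexx.
have closeN z0 z z' : X z0 -> X z -> X z' -> coords_le h z0 z ->
    coords_le h z z' -> ~ N (z, z') ->
    penorm (z - z') <= L * enorm ((z - z').1 - (z - z').2 *m (D2xy c z0)^T).
  move=> Xz0 Xz Xz' z0z zz' /negP nN; apply: close => //.
  by rewrite -crossedE.
have [k k0 count] := card_cell_index (d := d) K_ge0 h0.
have bfin : (\int[pi]_z (penorm z `^ q)%:E)%E \is a fin_num.
  rewrite ge0_fin_numE; first exact: moment_q.
  by apply: integral_ge0 => z _; rewrite lee_fin powR_ge0.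
set b := fine (\int[pi]_z (penorm z `^ q)%:E)%E.
have b0 : 0 <= b.
  by apply: fine_ge0; apply: integral_ge0 => z _; rewrite lee_fin powR_ge0.
apply: (@quant2_of_multiple R d pi k (Num.sqrt ((L * d%:R) ^+ 2 + b))) => //.
- by rewrite divr_ge0 // ltW.
- exact: moment_2.
move=> n n1; have nR0 : 0 < n%:R :> R by rewrite ltr0n.
have nR1 : 1 <= n%:R :> R by rewrite (ler_nat R 1).
have nR : n%:R != 0 :> R by rewrite gt_eqF.
pose s := n%:R `^ (- (1 / d')).
pose r := n%:R `^ ((d' - d%:R) / (2 * d%:R * d')).
have s0 : 0 < s by exact: powR_gt0.
have r0 : 0 < r by exact: powR_gt0.
have s1 : s <= 1.
  rewrite /s powRN invf_le1 ?powR_gt0 // -[leLHS](powRr0 n%:R).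
  by rewrite ler_powR // divr_ge0 // ltW.
have r1 : 1 <= r.
  by rewrite -[leLHS](powRr0 n%:R) ler_powR // divr_ge0 ?mulr_ge0 // ltW.
(* The exponents add up to [(d' - d) / d' + d / d' = 1]. *)
have rsn : r ^+ d * r ^+ d * s^-1 ^+ d = n%:R.
  rewrite /s powRN invrK /r !powR_expn -!powRD ?nR ?implybT //.
  rewrite -[RHS]powRr1 ?ler0n //; congr (_ `^ _); field.
  by rewrite (gt_eqF d0) gt_eqF.
(* The value of [q] enters here: [2 - q = - 4 d / (d' - d)], so both exponents of [n] equal
   [- 2 / d']. *)
have rq : r `^ (2 - q) = s ^+ 2.
  rewrite /r /s powR_expn -powRrM; congr (_ `^ _); rewrite /q; field.
  by rewrite (gt_eqF d0) (gt_eqF d'0) gt_eqF.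
have [P [mP closeP tailP]] := cell_cover r L0 h0 s0 KP closeN.
have e0 : 0 <= L * (d%:R * s) by rewrite !mulr_ge0 // ltW.
have [pin pin1 pin2] := quantization_W2 mX piX mN N0 mP closeP e0 r0 q2 tailP.
exists pin.
  exact: supported_on_at_most_le (count r s n r1 s0 s1 n1 rsn) pin1.
apply: le_trans (pin2 b b0 _) _; first by rewrite fineK.
rewrite lee_fin rq -/s (_ : _ + _ = ((L * d%:R) ^+ 2 + b) * s ^+ 2); last by ring.
by rewrite sqrtrM ?addr_ge0 ?sqr_ge0 // sqrtr_sqr ger0_norm // ltW.
Qed.
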